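(* Let $\mathcal{K}_1$ be a consistent $\mathcal{ALC}$ knowledge base, $\mathcal{K}_2$ a consistent Horn-$\mathcal{ALC}$ knowledge base, and $\Sigma$ a signature. Then $\mathcal{K}_1$ $\Sigma$-UCQ entails $\mathcal{K}_2$ if and only if $\mathcal{K}_1$ $\Sigma$-CQ entails $\mathcal{K}_2$. Likewise, $\mathcal{K}_1$ $\Sigma$-rUCQ entails $\mathcal{K}_2$ if and only if $\mathcal{K}_1$ $\Sigma$-rCQ entails $\mathcal{K}_2$. The same two equivalences hold for TBox entailment: for an $\mathcal{ALC}$ TBox $\mathcal{T}_1$, a Horn-$\mathcal{ALC}$ TBox $\mathcal{T}_2$ and a pair of signatures $\Theta=(\Sigma_1,\Sigma_2)$, $\mathcal{T}_1$ $\Theta$-UCQ entails $\mathcal{T}_2$ iff $\mathcal{T}_1$ $\Theta$-CQ entails $\mathcal{T}_2$, and $\mathcal{T}_1$ $\Theta$-rUCQ entails $\mathcal{T}_2$ iff $\mathcal{T}_1$ $\Theta$-rCQ entails $\mathcal{T}_2$.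
   Context: $\mathcal{ALC}$ concepts are built from concept names $A$ and $\top$ using $\neg C$, $C_1\sqcap C_2$ and $\exists R.C$ ($R$ a role name); $\bot,\sqcup,\forall R.C$ are the usual abbreviations. A TBox is a finite set of concept inclusions $C\sqsubseteq D$. A TBox is Horn-$\mathcal{ALC}$ if no concept of the form $\neg C$ occurs negatively and no concept of the form $\exists R.\neg C$ occurs positively in it. An ABox is a finite set of assertions $A(a)$, $R(a,b)$ with individual names $a,b$; $\mathsf{ind}(\mathcal{A})$ is its set of individuals. A knowledge base (KB) is $\mathcal{K}=(\mathcal{T},\mathcal{A})$ with $\mathsf{ind}(\mathcal{K})=\mathsf{ind}(\mathcal{A})$; it is Horn-$\mathcal{ALC}$ if $\mathcal{T}$ is. Interpretations satisfy the standard name assumption $a^{\mathcal{I}}=a$. A conjunctive query (CQ) $q(\vec x)=\exists\vec y\,\varphi(\vec x,\vec y)$ with $\varphi$ a conjunction of atoms $A(z)$, $R(z,z')$ over variables in $\vec x,\vec y$; $\vec x$ are the answer variables. It is rooted (rCQ) if every $y\in\vec y$ is connected to some answer variable in the undirected graph whose edges are $\{u,v\}$ with $R(u,v)$ in $q$. A UCQ is a disjunction of CQs with the same answer variables; an rUCQ is a UCQ all of whose disjuncts are rooted. $\mathcal{K}\models q(\vec a)$ means $\mathcal{I}\models q(\vec a)$ for every model $\mathcal{I}$ of $\mathcal{K}$. A signature is a set of concept and role names; a $\Sigma$-query uses only symbols in $\Sigma$. For consistent KBs $\mathcal{K}_1,\mathcal{K}_2$ and a class $\mathcal{Q}\in\{$CQ,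 rCQ, UCQ, rUCQ$\}$, $\mathcal{K}_1$ $\Sigma$-$\mathcal{Q}$ entails $\mathcal{K}_2$ if for every $\Sigma$-query $q(\vec x)$ in $\mathcal{Q}$ and every tuple $\vec a$ from $\mathsf{ind}(\mathcal{K}_2)$, $\mathcal{K}_2\models q(\vec a)$ implies $\vec a\subseteq\mathsf{ind}(\mathcal{K}_1)$ and $\mathcal{K}_1\models q(\vec a)$. For TBoxes $\mathcal{T}_1,\mathcal{T}_2$ and $\Theta=(\Sigma_1,\Sigma_2)$, $\mathcal{T}_1$ $\Theta$-$\mathcal{Q}$ entails $\mathcal{T}_2$ if for every ABox $\mathcal{A}$ using only symbols from $\Sigma_1$ that is consistent with both $\mathcal{T}_1$ and $\mathcal{T}_2$, the KB $(\mathcal{T}_1,\mathcal{A})$ $\Sigma_2$-$\mathcal{Q}$ entails $(\mathcal{T}_2,\mathcal{A})$. *)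

(* Defs.v *)
From Stdlib Require Import List Relations.
Import ListNotations.

(* Each kind of name ranges over its own countably infinite supply. *)
Definition cname := nat.
Definition rname := nat.
Definition iname := nat.
Definition var := nat.

Inductive concept : Type :=
| CName (A : cname)
| CTop
| CNot (C : concept)
| CAnd (C1 C2 : concept)
| CEx (R : rname) (C : concept).

Record inclusion : Type := Incl { lhs : concept; rhs : concept }.
Definition tbox : Type := list inclusion.

Inductive assertion : Type :=
| AConcept (A : cname) (a : iname)
| ARole (R : rname) (a b : iname).
Definition abox : Type := list assertion.

Record kb : Type := KB { kb_tbox : tbox; kb_abox : abox }.

Definition inds_assertion (s : assertion) : list iname :=
  match s with AConcept _ a => [a] | ARole _ a b => [a; b] end.
Definition inds_abox (A : abox) : list iname := flat_map inds_assertion A.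
Definition inds_kb (K : kb) : list iname := inds_abox (kb_abox K).

(* The standard name assumption [a^I = a] says that the individual names are
   elements of the domain; here they are embedded injectively into it. *)
Record interp : Type := Interp {
  dom : Type;
  iind : iname -> dom;
  iind_inj : forall a b, iind a = iind b -> a = b;
  icon : cname -> dom -> Prop;
  irole : rname -> dom -> dom -> Prop
}.

Fixpoint ext (I : interp) (C : concept) (d : dom I) : Prop :=
  match C with
  | CName A => icon I A d
  | CTop => True
  | CNot C => ~ ext I C d
  | CAnd C1 C2 => ext I C1 d /\ ext I C2 d
  | CEx R C => exists e, irole I R d e /\ ext I C e
  end.

Definition sat_inclusion (I : interp) (i : inclusion) : Prop :=
  forall d, ext I (lhs i) d -> ext I (rhs i) d.

Definition sat_assertion (I : interp) (s : assertion) : Prop :=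
  match s with
  | AConcept A a => icon I A (iind I a)
  | ARole R a b => irole I R (iind I a) (iind I b)
  end.

Definition model (I : interp) (K : kb) : Prop :=
  Forall (sat_inclusion I) (kb_tbox K) /\ Forall (sat_assertion I) (kb_abox K).

Definition consistent (K : kb) : Prop := exists I, model I K.

Inductive polarity : Set := Pos | Neg.
Definition flip (p : polarity) : polarity :=
  match p with Pos => Neg | Neg => Pos end.

(* [occurs C p D]: [C] occurs in [D] with polarity [p]. *)
Inductive occurs (C : concept) : polarity -> concept -> Prop :=
| occurs_self : occurs C Pos C
| occurs_not p D : occurs C p D -> occurs C (flip p) (CNot D)
| occurs_andl p D E : occurs C p D -> occurs C p (CAnd D E)
| occurs_andr p D E : occurs C p E -> occurs C p (CAnd D E)
| occurs_ex p R D : occurs C p D -> occurs C p (CEx R D).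

(* Left-hand sides of inclusions reverse polarity. *)
Definition occurs_in_tbox (C : concept) (p : polarity) (T : tbox) : Prop :=
  exists i, In i T /\ (occurs C (flip p) (lhs i) \/ occurs C p (rhs i)).

(* Bottom, disjunction and value restriction are abbreviations, so occurrences
   are counted after unfolding them.  In particular a value restriction on a
   right-hand side is excluded, being [CNot (CEx R (CNot C))]. *)
Definition horn (T : tbox) : Prop :=
  (forall C, ~ occurs_in_tbox (CNot C) Neg T) /\
  (forall R C, ~ occurs_in_tbox (CEx R (CNot C)) Pos T).

Record signature : Type := Sig {
  sig_c : cname -> Prop;
  sig_r : rname -> Prop
}.

Definition abox_over (S : signature) (A : abox) : Prop :=
  Forall (fun s => match s with
                   | AConcept A _ => sig_c S A
                   | ARole R _ _ => sig_r S R
                   end) A.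

Inductive atom : Type :=
| QConcept (A : cname) (z : var)
| QRole (R : rname) (z z' : var).

Definition atom_vars (t : atom) : list var :=
  match t with QConcept _ z => [z] | QRole _ z z' => [z; z'] end.

Definition atom_over (S : signature) (t : atom) : Prop :=
  match t with
  | QConcept A _ => sig_c S A
  | QRole R _ _ => sig_r S R
  end.

Definition sat_atom (I : interp) (s : var -> dom I) (t : atom) : Prop :=
  match t with
  | QConcept A z => icon I A (s z)
  | QRole R z z' => irole I R (s z) (s z')
  end.

Record cq : Type := CQ {
  ans_vars : list var;
  ex_vars : list var;
  atoms : list atom
}.

Definition wf_cq (q : cq) : Prop :=
  NoDup (ans_vars q ++ ex_vars q) /\
  Forall (fun t => incl (atom_vars t) (ans_vars q ++ ex_vars q)) (atoms q).

Definition cq_over (S : signature) (q : cq) : Prop :=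
  Forall (atom_over S) (atoms q).

Definition cq_holds (I : interp) (q : cq) (a : list iname) : Prop :=
  exists s : var -> dom I,
    map s (ans_vars q) = map (iind I) a /\ Forall (sat_atom I s) (atoms q).

Definition edge (q : cq) (u v : var) : Prop :=
  exists R, In (QRole R u v) (atoms q).

Definition connected (q : cq) : var -> var -> Prop :=
  clos_refl_sym_trans var (edge q).

Definition rooted (q : cq) : Prop :=
  forall y, In y (ex_vars q) ->
    exists x, In x (ans_vars q) /\ connected q y x.

Record ucq : Type := UCQ {
  uans_vars : list var;
  disjuncts : list cq
}.

Definition wf_ucq (q : ucq) : Prop :=
  disjuncts q <> [] /\
  Forall (fun p => wf_cq p /\ ans_vars p = uans_vars q) (disjuncts q).

Definition ucq_over (S : signature) (q : ucq) : Prop :=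
  Forall (cq_over S) (disjuncts q).

Definition ucq_holds (I : interp) (q : ucq) (a : list iname) : Prop :=
  Exists (fun p => cq_holds I p a) (disjuncts q).

Definition urooted (q : ucq) : Prop := Forall rooted (disjuncts q).

Record query_class : Type := QueryClass {
  query : Type;
  in_class : query -> Prop;
  query_over : signature -> query -> Prop;
  query_ans : query -> list var;
  query_holds : interp -> query -> list iname -> Prop
}.

Definition class_CQ : query_class :=
  QueryClass cq wf_cq cq_over ans_vars cq_holds.
Definition class_rCQ : query_class :=
  QueryClass cq (fun q => wf_cq q /\ rooted q) cq_over ans_vars cq_holds.
Definition class_UCQ : query_class :=
  QueryClass ucq wf_ucq ucq_over uans_vars ucq_holds.
Definition class_rUCQ : query_class :=
  QueryClass ucq (fun q => wf_ucq q /\ urooted q) ucq_over uans_vars ucq_holds.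

Definition certain (Q : query_class) (K : kb) (q : query Q) (a : list iname)
    : Prop :=
  forall I, model I K -> query_holds Q I q a.

Definition kb_entails (Q : query_class) (S : signature) (K1 K2 : kb) : Prop :=
  forall (q : query Q) (a : list iname),
    in_class Q q -> query_over Q S q ->
    length a = length (query_ans Q q) ->
    incl a (inds_kb K2) ->
    certain Q K2 q a ->
    incl a (inds_kb K1) /\ certain Q K1 q a.

Definition tbox_entails (Q : query_class) (S1 S2 : signature) (T1 T2 : tbox)
    : Prop :=
  forall A : abox,
    abox_over S1 A -> consistent (KB T1 A) -> consistent (KB T2 A) ->
    kb_entails Q S2 (KB T1 A) (KB T2 A).

(* Main.v *)
(** Models of a Horn TBox are closed under direct products: a left-hand side is
    negation-free, so it is preserved by the two projections, while a right-hand
    side negates only negation-free concepts, so it holds at a pair as soon as it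
    holds at both components.  Conjunctive queries are preserved by the projections
    as well.  Hence, if a Horn knowledge base entails no disjunct of a UCQ, the
    product of countermodels for the disjuncts refutes the whole UCQ; a UCQ that is
    entailed can therefore be replaced by one of its disjuncts. *)

From Stdlib Require Import List Classical.
Require Import Defs.
Import ListNotations.

Definition no_negation (p : polarity) (C : concept) : Prop :=
  forall D, ~ occurs (CNot D) p C.

Lemma not_no_negation_Pos_not (C : concept) : ~ no_negation Pos (CNot C).
Proof. intros H. exact (H C (occurs_self _)). Qed.

Lemma no_negation_not (p : polarity) (C : concept) :
  no_negation (flip p) (CNot C) -> no_negation p C.
Proof. intros H D HD. apply (H D). now constructor. Qed.

Lemma no_negation_and (p : polarity) (C1 C2 : concept) :
  no_negation p (CAnd C1 C2) -> no_negation p C1 /\ no_negation p C2.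
Proof. intros H. split; intros D HD; apply (H D); now constructor. Qed.

Lemma no_negation_ex (p : polarity) (R : rname) (C : concept) :
  no_negation p (CEx R C) -> no_negation p C.
Proof. intros H D HD. apply (H D). now constructor. Qed.

Lemma horn_no_negation (T : tbox) (i : inclusion) :
  horn T -> In i T -> no_negation Pos (lhs i) /\ no_negation Neg (rhs i).
Proof.
  intros [Hneg _] Hi. split; intros D HD; apply (Hneg D); exists i; split; auto.
Qed.

Record homomorphism (I J : interp) (h : dom I -> dom J) : Prop := {
  hom_ind : forall a, h (iind I a) = iind J a;
  hom_con : forall A d, icon I A d -> icon J A (h d);
  hom_role : forall R d e, irole I R d e -> irole J R (h d) (h e)
}.

Definition preserved_by_homs (P : interp -> Prop) : Prop :=
  forall I J h, homomorphism I J h -> P I -> P J.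

Lemma hom_ext (I J : interp) (h : dom I -> dom J) (C : concept) (d : dom I) :
  homomorphism I J h -> no_negation Pos C -> ext I C d -> ext J C (h d).
Proof.
  intros Hh. revert d.
  induction C as [A | | C _ | C1 IH1 C2 IH2 | R C IH]; simpl; intros d HC.
  - apply (hom_con _ _ _ Hh).
  - trivial.
  - now apply not_no_negation_Pos_not in HC.
  - apply no_negation_and in HC as [HC1 HC2].
    intros [Hd1 Hd2]. split; [now apply IH1 | now apply IH2].
  - apply no_negation_ex in HC.
    intros [e [Hde He]]. exists (h e).
    split; [now apply (hom_role _ _ _ Hh) | now apply IH].
Qed.

Lemma hom_sat_atom (I J : interp) (h : dom I -> dom J) (s : var -> dom I) (t : atom) :
  homomorphism I J h -> sat_atom I s t -> sat_atom J (fun z => h (s z)) t.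
Proof.
  intros Hh. destruct t; [apply (hom_con _ _ _ Hh) | apply (hom_role _ _ _ Hh)].
Qed.

Lemma cq_holds_preserved_by_homs (q : cq) (a : list iname) :
  preserved_by_homs (fun I => cq_holds I q a).
Proof.
  intros I J h Hh [s [Hans Hat]]. exists (fun z => h (s z)). split.
  - rewrite <- (map_map s h), Hans, map_map. apply map_ext, (hom_ind _ _ _ Hh).
  - eapply Forall_impl; [|exact Hat]. intros t. now apply hom_sat_atom.
Qed.

Definition prod_interp (I J : interp) : interp := {|
  dom := dom I * dom J;
  iind := fun a => (iind I a, iind J a);
  iind_inj := fun a b E => iind_inj I a b (f_equal fst E);
  icon := fun A d => icon I A (fst d) /\ icon J A (snd d);
  irole := fun R d e => irole I R (fst d) (fst e) /\ irole J R (snd d) (snd e)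
|}.

Definition closed_under_prod (M : interp -> Prop) : Prop :=
  forall I J, M I -> M J -> M (prod_interp I J).

Lemma homomorphism_fst (I J : interp) : homomorphism (prod_interp I J) I fst.
Proof. split; simpl; tauto. Qed.

Lemma homomorphism_snd (I J : interp) : homomorphism (prod_interp I J) J snd.
Proof. split; simpl; tauto. Qed.

Lemma ext_prod_interp (I J : interp) (C : concept) (d : dom (prod_interp I J)) :
  no_negation Neg C -> ext I C (fst d) -> ext J C (snd d) -> ext (prod_interp I J) C d.
Proof.
  revert d. induction C as [A | | C _ | C1 IH1 C2 IH2 | R C IH]; simpl; intros d HC.
  - now split.
  - trivial.
  - intros HI _ Hd. apply HI.
    exact (hom_ext _ _ _ _ _ (homomorphism_fst I J) (no_negation_not Pos C HC) Hd).
  - apply no_negation_and in HC as [HC1 HC2].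
    intros [HI1 HI2] [HJ1 HJ2]. split; [now apply IH1 | now apply IH2].
  - apply no_negation_ex in HC.
    intros [e [Hde He]] [f [Hdf Hf]]. exists (e, f). split; [now split | now apply IH].
Qed.

Lemma sat_inclusion_closed_under_prod (i : inclusion) :
  no_negation Pos (lhs i) -> no_negation Neg (rhs i) ->
  closed_under_prod (fun I => sat_inclusion I i).
Proof.
  intros Hlhs Hrhs I J HI HJ d Hd. apply ext_prod_interp; [assumption | |].
  - apply HI. exact (hom_ext _ _ _ _ _ (homomorphism_fst I J) Hlhs Hd).
  - apply HJ. exact (hom_ext _ _ _ _ _ (homomorphism_snd I J) Hlhs Hd).
Qed.

Lemma sat_assertion_closed_under_prod (s : assertion) :
  closed_under_prod (fun I => sat_assertion I s).
Proof. intros I J. destruct s; now split. Qed.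

Lemma Forall_closed_under_prod (X : Type) (P : interp -> X -> Prop) (xs : list X) :
  (forall x, In x xs -> closed_under_prod (fun I => P I x)) ->
  closed_under_prod (fun I => Forall (P I) xs).
Proof.
  intros HP I J HI HJ. rewrite Forall_forall in *.
  intros x Hx. apply HP; auto.
Qed.

Lemma horn_model_closed_under_prod (K : kb) :
  horn (kb_tbox K) -> closed_under_prod (fun I => model I K).
Proof.
  intros Hhorn I J [HTI HAI] [HTJ HAJ]. split.
  - apply Forall_closed_under_prod; try assumption. intros i Hi.
    destruct (horn_no_negation _ _ Hhorn Hi) as [Hlhs Hrhs].
    now apply sat_inclusion_closed_under_prod.
  - apply Forall_closed_under_prod; try assumption. intros s _.
    apply sat_assertion_closed_under_prod.
Qed.

Section DisjunctionProperty.

Variables (M : interp -> Prop) (X : Type) (P : interp -> X -> Prop).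
Hypothesis M_inhabited : exists I, M I.
Hypothesis M_prod : closed_under_prod M.
Hypothesis P_hom : forall x, preserved_by_homs (fun I => P I x).

Lemma common_countermodel (xs : list X) :
  Forall (fun x => exists I, M I /\ ~ P I x) xs ->
  exists I, M I /\ Forall (fun x => ~ P I x) xs.
Proof.
  destruct M_inhabited as [I0 HI0]. intros Hxs.
  induction Hxs as [| x xs [I [HI Hx]] _ [J [HJ Hxs]]].
  - now exists I0.
  - exists (prod_interp I J). split; [now apply M_prod|]. constructor.
    + intros H. apply Hx. exact (P_hom _ _ _ _ (homomorphism_fst I J) H).
    + eapply Forall_impl; [|exact Hxs]. intros y Hy H.
      apply Hy. exact (P_hom _ _ _ _ (homomorphism_snd I J) H).
Qed.

Lemma disjunction_property (xs : list X) :
  (forall I, M I -> Exists (P I) xs) -> Exists (fun x => forall I, M I -> P I x) xs.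
Proof.
  intros Hxs. apply NNPP. intros Hno. apply Forall_Exists_neg in Hno.
  destruct (common_countermodel xs) as [I [HI Hrefuted]].
  - eapply Forall_impl; [|exact Hno]. intros x Hx.
    apply not_all_ex_not in Hx as [I HI]. exists I. now apply imply_to_and.
  - apply Forall_Exists_neg in Hrefuted. exact (Hrefuted (Hxs I HI)).
Qed.

End DisjunctionProperty.

Lemma horn_certain_disjunct (K : kb) (q : ucq) (a : list iname) :
  consistent K -> horn (kb_tbox K) -> certain class_UCQ K q a ->
  exists p, In p (disjuncts q) /\ certain class_CQ K p a.
Proof.
  intros HK Hhorn Hq. apply Exists_exists.
  apply (disjunction_property (fun I => model I K) cq (fun I p => cq_holds I p a)).
  - exact HK.
  - now apply horn_model_closed_under_prod.
  - intros p. apply cq_holds_preserved_by_homs.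
  - exact Hq.
Qed.

Definition contained {Q Q' : query_class} (p : query Q) (q : query Q') : Prop :=
  forall I a, query_holds Q I p a -> query_holds Q' I q a.

Lemma certain_contained (Q Q' : query_class) (p : query Q) (q : query Q') (K : kb)
    (a : list iname) :
  contained p q -> certain Q K p a -> certain Q' K q a.
Proof. intros Hpq Hp I HI. now apply Hpq, Hp. Qed.

Lemma kb_entails_by_contained_queries (Q Q' : query_class) (S : signature) (K1 K2 : kb) :
  (forall (q : query Q') a,
     in_class Q' q -> query_over Q' S q -> certain Q' K2 q a ->
     exists p : query Q,
       in_class Q p /\ query_over Q S p /\ query_ans Q p = query_ans Q' q /\
       contained p q /\ certain Q K2 p a) ->
  kb_entails Q S K1 K2 -> kb_entails Q' S K1 K2.
Proof.
  intros Hred HE q a Hq Hover Hlen Ha Hcert.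
  destruct (Hred q a Hq Hover Hcert) as [p [Hp [Hpover [Hans [Hpq Hpcert]]]]].
  rewrite <- Hans in Hlen.
  destruct (HE p a Hp Hpover Hlen Ha Hpcert) as [Ha1 Hpcert1].
  split; [assumption | now apply (certain_contained _ _ p)].
Qed.

Definition cq_class (C : cq -> Prop) : query_class :=
  QueryClass cq C cq_over ans_vars cq_holds.

Definition ucq_class (U : ucq -> Prop) : query_class :=
  QueryClass ucq U ucq_over uans_vars ucq_holds.

Definition singleton_ucq (q : cq) : ucq := UCQ (ans_vars q) [q].

Lemma wf_singleton_ucq (q : cq) : wf_cq q -> wf_ucq (singleton_ucq q).
Proof. intros Hq. split; [discriminate | now apply Forall_cons]. Qed.

Lemma singleton_ucq_holds (I : interp) (q : cq) (a : list iname) :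
  ucq_holds I (singleton_ucq q) a <-> cq_holds I q a.
Proof.
  unfold ucq_holds. simpl. rewrite Exists_cons, Exists_nil. tauto.
Qed.

Lemma kb_entails_cq_of_ucq (C : cq -> Prop) (U : ucq -> Prop) (S : signature)
    (K1 K2 : kb) :
  (forall q, C q -> U (singleton_ucq q)) ->
  kb_entails (ucq_class U) S K1 K2 -> kb_entails (cq_class C) S K1 K2.
Proof.
  intros HCU. apply kb_entails_by_contained_queries. intros q a Hq Hover Hcert.
  exists (singleton_ucq q). repeat split.
  - now apply HCU.
  - now apply Forall_cons.
  - intros I b. apply singleton_ucq_holds.
  - intros I HI. now apply singleton_ucq_holds, Hcert.
Qed.

Lemma kb_entails_ucq_of_cq (C : cq -> Prop) (U : ucq -> Prop) (S : signature)
    (K1 K2 : kb) :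
  (forall q p, U q -> In p (disjuncts q) -> C p /\ ans_vars p = uans_vars q) ->
  consistent K2 -> horn (kb_tbox K2) ->
  kb_entails (cq_class C) S K1 K2 -> kb_entails (ucq_class U) S K1 K2.
Proof.
  intros HUC HK2 Hhorn. apply kb_entails_by_contained_queries. intros q a Hq Hover Hcert.
  destruct (horn_certain_disjunct K2 q a HK2 Hhorn Hcert) as [p [Hp Hpcert]].
  destruct (HUC q p Hq Hp) as [HCp Hans].
  exists p. repeat split; try assumption.
  - exact (proj1 (Forall_forall _ _) Hover p Hp).
  - intros I b Hpb. apply Exists_exists. now exists p.
Qed.

Lemma kb_entails_UCQ_iff_CQ (S : signature) (K1 K2 : kb) :
  consistent K2 -> horn (kb_tbox K2) ->
  kb_entails class_UCQ S K1 K2 <-> kb_entails class_CQ S K1 K2.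
Proof.
  intros HK2 Hhorn. split.
  - apply kb_entails_cq_of_ucq, wf_singleton_ucq.
  - apply kb_entails_ucq_of_cq; try assumption.
    intros q p [_ Hwf]. rewrite Forall_forall in Hwf. apply Hwf.
Qed.

Lemma kb_entails_rUCQ_iff_rCQ (S : signature) (K1 K2 : kb) :
  consistent K2 -> horn (kb_tbox K2) ->
  kb_entails class_rUCQ S K1 K2 <-> kb_entails class_rCQ S K1 K2.
Proof.
  intros HK2 Hhorn. split.
  - apply kb_entails_cq_of_ucq. intros q [Hwf Hrooted].
    split; [now apply wf_singleton_ucq | now apply Forall_cons].
  - apply kb_entails_ucq_of_cq; try assumption.
    intros q p [[_ Hwf] Hrooted] Hp.
    unfold urooted in Hrooted. rewrite Forall_forall in Hwf, Hrooted.
    destruct (Hwf p Hp) as [Hpwf Hans].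
    split; [split; [assumption | now apply Hrooted] | assumption].
Qed.

Lemma tbox_entails_iff (Q Q' : query_class) (S1 S2 : signature) (T1 T2 : tbox) :
  (forall A, consistent (KB T2 A) ->
     kb_entails Q S2 (KB T1 A) (KB T2 A) <-> kb_entails Q' S2 (KB T1 A) (KB T2 A)) ->
  tbox_entails Q S1 S2 T1 T2 <-> tbox_entails Q' S1 S2 T1 T2.
Proof.
  intros H. split; intros HE A HA H1 H2; apply (H A H2); now apply HE.
Qed.

Theorem theorem1 :
  (forall (K1 K2 : kb) (S : signature),
     consistent K1 -> consistent K2 -> horn (kb_tbox K2) ->
     (kb_entails class_UCQ S K1 K2 <-> kb_entails class_CQ S K1 K2) /\
     (kb_entails class_rUCQ S K1 K2 <-> kb_entails class_rCQ S K1 K2)) /\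
  (forall (T1 T2 : tbox) (S1 S2 : signature),
     horn T2 ->
     (tbox_entails class_UCQ S1 S2 T1 T2 <-> tbox_entails class_CQ S1 S2 T1 T2) /\
     (tbox_entails class_rUCQ S1 S2 T1 T2 <-> tbox_entails class_rCQ S1 S2 T1 T2)).
Proof.
  split.
  - intros K1 K2 S _ HK2 Hhorn. split.
    + now apply kb_entails_UCQ_iff_CQ.
    + now apply kb_entails_rUCQ_iff_rCQ.
  - intros T1 T2 S1 S2 Hhorn. split; apply tbox_entails_iff; intros A HA.
    + now apply kb_entails_UCQ_iff_CQ.
    + now apply kb_entails_rUCQ_iff_rCQ.
Qed.
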